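(* (General solution for four-stage third-order 2N-storage methods.) Let $c_1=0$ and let $c_2,c_3,c_4$ be nonzero real numbers with $c_2\neq c_3$ and $c_3\ne c_4$. Let $b_1,b_2,b_3,b_4$ be real numbers with $b_2,b_3,b_4\ne0$, $b_1+b_2-c_2\neq0$ and $b_1+b_2+b_3-c_3\ne0$. Then $c_i$, $b_i$ are the nodes and weights of a four-stage explicit 2N-storage Runge-Kutta method satisfying the third-order conditions $$\sum_i b_i=1,\quad \sum_i b_ic_i=\tfrac12,\quad \sum_i b_ic_i^2=\tfrac13,\quad \sum_{i,j}b_ia_{ij}c_j=\tfrac16$$ if and only if $$b_1=1-b_2-b_3-b_4,$$ $$b_3=\frac{c_4/2-1/3}{c_3(c_4-c_3)}-\frac{c_2(c_4-c_2)}{c_3(c_4-c_3)}\,b_2,\qquad b_4=\frac{1/3-c_3/2}{c_4(c_4-c_3)}+\frac{c_2(c_3-c_2)}{c_4(c_4-c_3)}\,b_2,$$ and $x=b_2c_2$ satisfies the quadratic equation $$\frac16 z_1(z_2-z_3)+\Big[z_1z_4+z_3z_5+\frac16(z_2+z_1)(c_3-c_2)\Big]x+(c_3-c_2)\big[z_4-z_5-(c_4-c_2)(z_1+z_3)\big]x^2=0,$$ where $$z_1=c_3c_4(1-c_2)-\tfrac12(c_3+c_4)+\tfrac13,\qquad z_2=c_3+c_4-\tfrac32c_3c_4-\tfrac23,$$ $$z_3=c_4(c_4-c_3)(1-c_3)+\tfrac12c_3-\tfrac13,$$ $$z_4=c_3c_4-\tfrac12c_2(c_3+c_4)-\tfrac13(c_3+c_4-2c_2),$$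 $$z_5=\tfrac12(c_3c_4-c_2c_3-c_2c_4)+\tfrac12c_2-\tfrac16(c_3+c_4).$$ In that case the remaining coefficients of the method are given, for $2\le j<i\le4$, recursively (for each $i$, with $j$ decreasing from $i-1$) by $$a_{ij}=\frac{b_j}{\sum_{k=1}^{j}b_k-c_j}\Big[c_i-c_j-\sum_{k=j+1}^{i-1}a_{ik}\Big],$$ and by $a_{i1}=c_i-\sum_{k=2}^{i-1}a_{ik}$ for $i=2,3,4$.
   Context: Empty sums equal $0$. An $s$-stage explicit Runge-Kutta method ($a$-form) has real coefficients $a_{ij}$ ($i,j=1,\dots,s$, $a_{ij}=0$ for $i\le j$), weights $b_i$ and nodes $c_i=\sum_{j=1}^{i-1}a_{ij}$ (so $c_1=0$). With step size $h$ it computes $y_i=y_0+h\sum_{j=1}^{i-1}a_{ij}k_j$, $k_i=f(t+c_ih,y_i)$, $i=1,\dots,s$, and $y_{s+1}=y_0+h\sum_{i=1}^s b_ik_i$. 2N-storage method ($A$-form): the method is a 2N-storage method if there are coefficients $A_1=0,A_2,\dots,A_s$ and $B_1,\dots,B_s$, all $B_i\ne0$, such that its stages coincide (identically, as formal linear combinations of $y_0$ and $k_1,\dots,k_s$, treated as independent symbols) with those produced by $y_1=y_0$, $\Delta y_2=hk_1$, $\Delta y_i=A_{i-1}\Delta y_{i-1}+hk_{i-1}$ for $i=3,\dots,s+1$, and $y_i=y_{i-1}+B_{i-1}\Delta y_i$ for $i=2,\dots,s+1$. *)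

(* Defs.v *)
From mathcomp Require Export all_boot all_order all_algebra.
From mathcomp Require Export reals.

Set Implicit Arguments.
Unset Strict Implicit.
Unset Printing Implicit Defensive.

Export GRing.Theory Num.Theory.

#[global] Open Scope ring_scope.

(* Stage indices are natural numbers running over 1, ..., s (over
   1, ..., s + 1 for the y_i); values outside these ranges are never used. *)

Record explicit_rk (R : realType) (s : nat) := ExplicitRK {
  rk_a : nat -> nat -> R;
  rk_b : nat -> R;
  rk_explicit : forall i j : nat,
    (1 <= i <= s)%N -> (1 <= j <= s)%N -> (i <= j)%N -> rk_a i j = 0 }.

Definition rk_c (R : realType) (s : nat) (M : explicit_rk R s) (i : nat) : R :=
  \sum_(1 <= j < i) rk_a M i j.

Section Stages.
Variables (R : realType) (V : lmodType R) (h : R) (y0 : V) (k : nat -> V).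

Definition rk_stage (s : nat) (M : explicit_rk R s) (i : nat) : V :=
  y0 + h *: \sum_(1 <= j < i) rk_a M i j *: k j.

Definition rk_update (s : nat) (M : explicit_rk R s) : V :=
  y0 + h *: \sum_(1 <= i < s.+1) rk_b M i *: k i.

Variables (A B : nat -> R).

(* Delta y_i, which the scheme uses for i >= 2 only *)
Fixpoint lowstorage_dy (i : nat) : V :=
  match i with
  | 0 | 1 => 0
  | 2 => h *: k 1
  | i'.+1 => A i' *: lowstorage_dy i' + h *: k i'
  end.

Fixpoint lowstorage_y (i : nat) : V :=
  match i with
  | 0 | 1 => y0
  | i'.+1 => lowstorage_y i' + B i' *: lowstorage_dy i
  end.

End Stages.

(* Formal linear combinations of y_0, k_1, ..., k_s are row vectors of length
   s + 1: y_0 is the basis vector of index 0 and k_j that of index j. *)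
Definition sym_y0 (R : realType) (s : nat) : 'rV[R]_s.+1 := delta_mx 0 0.
Definition sym_k (R : realType) (s : nat) (j : nat) : 'rV[R]_s.+1 :=
  delta_mx 0 (inord j).

Definition is_2N_storage (R : realType) (s : nat) (M : explicit_rk R s) : Prop :=
  exists A B : nat -> R,
    [/\ A 1%N = 0,
        forall i : nat, (1 <= i <= s)%N -> B i != 0 &
        forall h : R,
          (forall i : nat, (1 <= i <= s)%N ->
             rk_stage h (sym_y0 R s) (sym_k R s) M i
             = lowstorage_y h (sym_y0 R s) (sym_k R s) A B i)
          /\ rk_update h (sym_y0 R s) (sym_k R s) M
             = lowstorage_y h (sym_y0 R s) (sym_k R s) A B s.+1].

Definition third_order (R : realType) (s : nat) (M : explicit_rk R s) : Prop :=
  [/\ \sum_(1 <= i < s.+1) rk_b M i = 1,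
      \sum_(1 <= i < s.+1) rk_b M i * rk_c M i = 1 / 2,
      \sum_(1 <= i < s.+1) rk_b M i * rk_c M i ^+ 2 = 1 / 3 &
      \sum_(1 <= i < s.+1) \sum_(1 <= j < s.+1)
        rk_b M i * rk_a M i j * rk_c M j = 1 / 6].

Definition third_order_2N_with (R : realType) (s : nat) (c b : nat -> R)
    (M : explicit_rk R s) : Prop :=
  [/\ forall i : nat, (1 <= i <= s)%N -> rk_c M i = c i,
      forall i : nat, (1 <= i <= s)%N -> rk_b M i = b i,
      is_2N_storage M &
      third_order M].

Section Quadratic.
Variables (R : realType) (c2 c3 c4 : R).

Definition z1 : R := c3 * c4 * (1 - c2) - 1 / 2 * (c3 + c4) + 1 / 3.
Definition z2 : R := c3 + c4 - 3 / 2 * (c3 * c4) - 2 / 3.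
Definition z3 : R := c4 * (c4 - c3) * (1 - c3) + 1 / 2 * c3 - 1 / 3.
Definition z4 : R :=
  c3 * c4 - 1 / 2 * c2 * (c3 + c4) - 1 / 3 * (c3 + c4 - 2 * c2).
Definition z5 : R :=
  1 / 2 * (c3 * c4 - c2 * c3 - c2 * c4) + 1 / 2 * c2 - 1 / 6 * (c3 + c4).

Definition quadratic_lhs (x : R) : R :=
  1 / 6 * z1 * (z2 - z3)
  + (z1 * z4 + z3 * z5 + 1 / 6 * (z2 + z1) * (c3 - c2)) * x
  + (c3 - c2) * (z4 - z5 - (c4 - c2) * (z1 + z3)) * x ^+ 2.

End Quadratic.

(* Main.v *)
Require Import Defs.
From mathcomp Require Import ring zify.

(* Unrolling the 2N scheme gives a_ij = sum_(j <= l < i) B_l A_(j+1) ... A_l and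
   the same with i = s + 1 for b_j.  Hence a_ik - a_jk = A_(k+1) ... A_j a_ij for
   k <= j < i, and likewise b_k - a_jk = A_(k+1) ... A_j b_j.  Summing over
   k <= j and eliminating the common factor expresses a_ij through b, c and the
   a_ik with j < k < i.  For s = 4 these formulas conversely determine suitable
   A_i = (b_(i-1) - B_(i-1)) / b_i and B_i = a_(i+1)i.  The first three order
   conditions are linear in b_1, b_3, b_4, and the last one becomes the quadratic
   once the denominators are cleared. *)

Set Implicit Arguments.
Unset Strict Implicit.
Unset Printing Implicit Defensive.

(** * Unrolling the 2N recursion *)

Section StorageCoefficients.
Variables (R : realType) (A B : nat -> R).

(* Coefficient of [h k_j] in [y_i], obtained by unrolling the recursion: [k_j]
   enters [Delta y_(l+1)] with coefficient [A_(j+1) ... A_l]. *)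
Definition storage_coef (i j : nat) : R :=
  \sum_(j <= l < i) B l * \prod_(j.+1 <= m < l.+1) A m.

Lemma lowstorage_dyE (V : lmodType R) (h : R) (k : nat -> V) (i : nat) :
  lowstorage_dy h k A i.+1 =
  h *: \sum_(1 <= j < i.+1) (\prod_(j.+1 <= m < i.+1) A m) *: k j.
Proof.
elim: i => [|[|i] IH]; first by rewrite big_geq ?scaler0.
  by rewrite big_nat1 big_geq // scale1r.
rewrite [LHS]/= -/(lowstorage_dy h k A i.+2) IH [in RHS]big_nat_recr //=.
rewrite (@big_geq _ _ _ i.+3) // scale1r scalerDr scalerA mulrC -scalerA.
rewrite scaler_sumr; congr (_ *: _ + _); apply: eq_big_nat => j /andP[_ lt_j].
by rewrite scalerA mulrC (big_nat_recr i.+2).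
Qed.

Lemma lowstorage_yE (V : lmodType R) (h : R) (y0 : V) (k : nat -> V) (i : nat) :
  lowstorage_y h y0 k A B i.+1 =
  y0 + h *: \sum_(1 <= j < i.+1) storage_coef i.+1 j *: k j.
Proof.
elim: i => [|i IH]; first by rewrite big_geq // scaler0 addr0.
rewrite [LHS]/= -/(lowstorage_y h y0 k A B i.+1) -/(lowstorage_dy h k A i.+2).
rewrite IH lowstorage_dyE -addrA; congr (_ + _).
rewrite scalerA mulrC -scalerA -scalerDr; congr (_ *: _).
rewrite scaler_sumr !(big_nat_recr i.+1 1) //= addrA -big_split /=.
congr (_ + _).
  apply: eq_big_nat => j /andP[_ lt_j].
  by rewrite scalerA -scalerDl /storage_coef [in RHS]big_nat_recr // ltnW.
by rewrite scalerA /storage_coef big_nat1.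
Qed.

(** The terms with [l < j] cancel, and in each remaining one the product [A_(k+1) ... A_l] factors
    at [j]. *)
Lemma storage_coef_split (i j k : nat) : (k <= j)%N -> (j <= i)%N ->
  storage_coef i k - storage_coef j k =
  (\prod_(k.+1 <= m < j.+1) A m) * storage_coef i j.
Proof.
move=> le_kj le_ji; rewrite /storage_coef (big_cat_nat le_kj le_ji) /= addrAC subrr add0r.
rewrite mulr_sumr; apply: eq_big_nat => l /andP[le_jl _].
by rewrite mulrCA -big_cat_nat.
Qed.

Lemma sum_storage_coef (i j : nat) : (0 < j)%N -> (j <= i)%N ->
  \sum_(1 <= k < j.+1) storage_coef i k - \sum_(1 <= k < j) storage_coef j k =
  storage_coef i j * \sum_(1 <= k < j.+1) \prod_(k.+1 <= m < j.+1) A m.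
Proof.
move=> j_gt0 le_ji; rewrite mulr_sumr.
(* The diagonal term [storage_coef j j] is an empty sum, so adding it aligns the two ranges. *)
have -> : \sum_(1 <= k < j) storage_coef j k =
          \sum_(1 <= k < j.+1) storage_coef j k.
  by rewrite big_nat_recr //= [storage_coef j j]big_geq ?addr0.
rewrite -sumrB; apply: eq_big_nat => k /andP[_ le_kj].
by rewrite storage_coef_split // mulrC.
Qed.

End StorageCoefficients.

(** * From formal stages to relations between coefficients *)

Section Storage.
Variables (R : realType) (s : nat).

(** Reads off the coefficient of [k_j]: [y_0] occupies coordinate 0 and contributes nothing at
    [j > 0]. *)
Lemma sym_combE (f : nat -> R) (n j : nat) : (n <= s)%N -> (1 <= j <= n)%N ->
  (sym_y0 R s + 1 *: \sum_(1 <= l < n.+1) f l *: sym_k R s l) 0 (inord j) = f j.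
Proof.
move=> le_ns /andP[j_gt0 le_jn].
have j_lt : (j < s.+1)%N by lia.
rewrite scale1r mxE summxE /sym_y0 mxE -(val_eqE (inord j)) /= inordK // (gtn_eqF j_gt0) add0r.
rewrite (bigD1_seq j) ?mem_index_iota ?iota_uniq ?j_gt0 //=.
rewrite !mxE !eqxx mulr1 big1_seq ?addr0 // => l /andP[neq_lj].
rewrite mem_index_iota => lP.
have l_lt : (l < s.+1)%N by lia.
by rewrite !mxE -(val_eqE (inord j)) /= !inordK // eq_sym (negbTE neq_lj) mulr0.
Qed.

Lemma is_2N_storageP (M : explicit_rk R s) :
  is_2N_storage M <->
  exists A B : nat -> R,
    [/\ A 1%N = 0,
        forall i : nat, (1 <= i <= s)%N -> B i != 0,
        forall i j : nat, (1 <= j)%N -> (j < i)%N -> (i <= s)%N ->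
          rk_a M i j = storage_coef A B i j &
        forall j : nat, (1 <= j <= s)%N ->
          rk_b M j = storage_coef A B s.+1 j].
Proof.
split=> -[A [B [A1 B_neq0]]].
  (* Setting [h = 1] and comparing coordinate [j] isolates the coefficient of [k_j]. *)
  move=> /(_ 1)[eq_a eq_b]; exists A, B; split=> // [[//|i] j j_gt0 lt_ji lt_is|j jP].
    move: (congr1 (fun v : 'rV_s.+1 => v 0 (inord j)) (eq_a i.+1 lt_is)).
    by rewrite /rk_stage lowstorage_yE !sym_combE //; lia.
  move: (congr1 (fun v : 'rV_s.+1 => v 0 (inord j)) eq_b).
  by rewrite /rk_update lowstorage_yE !sym_combE //; lia.
move=> eq_a eq_b; exists A, B; split=> // h; split=> [[//|i] iP|].
  rewrite lowstorage_yE; congr (_ + _ *: _); apply: eq_big_nat => j jP.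
  by rewrite eq_a //; lia.
rewrite lowstorage_yE; congr (_ + _ *: _); apply: eq_big_nat => j jP.
by rewrite eq_b.
Qed.

(* Both differences are the factor [sum_(k <= j) A_(k+1) ... A_j] times the
   coefficient of [k_j], in [y_(s+1)] and in [y_i] respectively. *)
Lemma storage_relation (M : explicit_rk R s) (i j : nat) :
  is_2N_storage M -> (1 <= j)%N -> (j < i)%N -> (i <= s)%N ->
  rk_a M i j * (\sum_(1 <= k < j.+1) rk_b M k - rk_c M j) =
  rk_b M j * (\sum_(1 <= k < j.+1) rk_a M i k - rk_c M j).
Proof.
case/is_2N_storageP=> A [B [_ _ eq_a eq_b]] j_gt0 lt_ji le_is.
have -> : rk_c M j = \sum_(1 <= k < j) storage_coef A B j k.
  by apply: eq_big_nat => k kP; rewrite eq_a //; lia.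
have -> : \sum_(1 <= k < j.+1) rk_b M k =
          \sum_(1 <= k < j.+1) storage_coef A B s.+1 k.
  by apply: eq_big_nat => k kP; rewrite eq_b //; lia.
have -> : \sum_(1 <= k < j.+1) rk_a M i k =
          \sum_(1 <= k < j.+1) storage_coef A B i k.
  by apply: eq_big_nat => k kP; rewrite eq_a //; lia.
rewrite !sum_storage_coef ?eq_a ?eq_b //; try lia.
ring.
Qed.

Lemma rk_c_recr (M : explicit_rk R s) (i j : nat) : (j < i)%N ->
  rk_c M i = \sum_(1 <= k < j.+1) rk_a M i k + \sum_(j.+1 <= k < i) rk_a M i k.
Proof. by move=> lt_ji; rewrite -big_cat_nat. Qed.

(** In [storage_relation] the sum over [k <= j] still contains [a_ij]; splitting the row sum [c_i]
    at [j] trades it for the entries with [k > j], whence a recursion in decreasing [j]. *)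
Lemma storage_aE (M : explicit_rk R s) (i j : nat) :
  is_2N_storage M -> (1 <= j)%N -> (j < i)%N -> (i <= s)%N ->
  \sum_(1 <= k < j.+1) rk_b M k - rk_c M j != 0 ->
  rk_a M i j = rk_b M j / (\sum_(1 <= k < j.+1) rk_b M k - rk_c M j)
    * (rk_c M i - rk_c M j - \sum_(j.+1 <= k < i) rk_a M i k).
Proof.
move=> stM j_gt0 lt_ji le_is den_neq0; apply: (mulIf den_neq0).
rewrite storage_relation // (rk_c_recr M lt_ji) mulrAC divfK //.
by congr (_ * _); ring.
Qed.

End Storage.

(** * The four-stage case *)

Section FourStages.
Variable R : realType.

Lemma third_order4 (M : explicit_rk R 4) (c b : nat -> R) : c 1%N = 0 ->
  (forall i : nat, (1 <= i <= 4)%N -> rk_c M i = c i) ->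
  (forall i : nat, (1 <= i <= 4)%N -> rk_b M i = b i) ->
  third_order M <->
  [/\ b 1%N + b 2%N + b 3%N + b 4%N = 1,
      b 2%N * c 2%N + b 3%N * c 3%N + b 4%N * c 4%N = 1 / 2,
      b 2%N * c 2%N ^+ 2 + b 3%N * c 3%N ^+ 2 + b 4%N * c 4%N ^+ 2 = 1 / 3 &
      b 3%N * rk_a M 3 2 * c 2%N
      + b 4%N * (rk_a M 4 2 * c 2%N + rk_a M 4 3 * c 3%N) = 1 / 6].
Proof.
move=> c1 eq_c eq_b; rewrite /third_order /index_iota unlock /=.
have a0 := @rk_explicit _ _ M; rewrite !eq_c // !eq_b // c1 !(a0 1%N) //.
rewrite !(a0 2%N 2%N, a0 2%N 3%N, a0 2%N 4%N, a0 3%N 3%N, a0 3%N 4%N, a0 4%N 4%N) //.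
by split=> -[e1 e2 e3 e4];
  (split; [rewrite -e1 | rewrite -e2 | rewrite -e3 | rewrite -e4]); ring.
Qed.

(** For given [b2], the last two conditions are a linear system in [b3], [b4] with determinant
    [c3 * c4 * (c4 - c3)]. *)
Lemma quadrature_weights (b1 b2 b3 b4 c2 c3 c4 : R) :
  c3 != 0 -> c4 != 0 -> c3 != c4 ->
  [/\ b1 + b2 + b3 + b4 = 1,
      b2 * c2 + b3 * c3 + b4 * c4 = 1 / 2 &
      b2 * c2 ^+ 2 + b3 * c3 ^+ 2 + b4 * c4 ^+ 2 = 1 / 3] <->
  [/\ b1 = 1 - b2 - b3 - b4,
      b3 = (c4 / 2 - 1 / 3) / (c3 * (c4 - c3))
           - c2 * (c4 - c2) / (c3 * (c4 - c3)) * b2 &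
      b4 = (1 / 3 - c3 / 2) / (c4 * (c4 - c3))
           + c2 * (c3 - c2) / (c4 * (c4 - c3)) * b2].
Proof.
move=> c3_neq0 c4_neq0 neq34.
have d_neq0 : c4 - c3 != 0 by rewrite subr_eq0 eq_sym.
split=> [[e1 e2 e3]|[-> -> ->]]; last by split; field; rewrite ?c3_neq0 ?c4_neq0 ?d_neq0.
have half_mul c : c / 2 = c * (1 / 2) by rewrite mul1r.
split; first by rewrite -e1; ring.
  by rewrite half_mul -e2 -e3; field; rewrite c3_neq0 d_neq0.
by rewrite half_mul -e2 -e3; field; rewrite c4_neq0 d_neq0.
Qed.

(* Clearing denominators in the last order condition leaves exactly the
   quadratic: the terms of degree three in [b2] cancel. *)
Lemma quadratic_lhsE (b1 b2 b3 b4 c2 c3 c4 a32 a42 a43 : R) :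
  c3 != 0 -> c4 != 0 -> c3 != c4 ->
  b1 = 1 - b2 - b3 - b4 ->
  b3 = (c4 / 2 - 1 / 3) / (c3 * (c4 - c3))
       - c2 * (c4 - c2) / (c3 * (c4 - c3)) * b2 ->
  b4 = (1 / 3 - c3 / 2) / (c4 * (c4 - c3))
       + c2 * (c3 - c2) / (c4 * (c4 - c3)) * b2 ->
  b1 + b2 - c2 != 0 -> b1 + b2 + b3 - c3 != 0 ->
  a32 = b2 / (b1 + b2 - c2) * (c3 - c2) ->
  a43 = b3 / (b1 + b2 + b3 - c3) * (c4 - c3) ->
  a42 = b2 / (b1 + b2 - c2) * (c4 - c2 - a43) ->
  quadratic_lhs c2 c3 c4 (b2 * c2) =
  c3 * c4 ^+ 2 * (c4 - c3) * (b1 + b2 - c2) * (b1 + b2 + b3 - c3)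
  * (b3 * a32 * c2 + b4 * (a42 * c2 + a43 * c3) - 1 / 6).
Proof.
move=> c3_neq0 c4_neq0 neq34 b1E b3E b4E D2_neq0 D3_neq0 a32E a43E a42E.
have d_neq0 : c4 - c3 != 0 by rewrite subr_eq0 eq_sym.
have D3E : b1 + b2 + b3 - c3 = 1 - b4 - c3 by rewrite b1E; ring.
have D2E : b1 + b2 - c2 = 1 - b3 - b4 - c2 by rewrite b1E; ring.
rewrite D2E D3E; rewrite D2E in D2_neq0 a32E a42E; rewrite D3E in D3_neq0 a43E.
(* In this midpoint the denominators of the [a_ij] are cleared while [b3] and [b4] remain symbols;
   their closed forms enter only on the quadratic side. *)
transitivity (c3 * c4 ^+ 2 * (c4 - c3) *
  (b3 * b2 * (c3 - c2) * c2 * (1 - b4 - c3)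
   + b4 * c2 * b2 * ((c4 - c2) * (1 - b4 - c3) - b3 * (c4 - c3))
   + b4 * b3 * c3 * (c4 - c3) * (1 - b3 - b4 - c2)
   - (1 - b3 - b4 - c2) * (1 - b4 - c3) / 6)).
  rewrite b3E b4E /quadratic_lhs /z1 /z2 /z3 /z4 /z5.
  by field; rewrite ?c3_neq0 ?c4_neq0 ?d_neq0.
by rewrite a42E a32E a43E; field; rewrite ?D2_neq0 ?D3_neq0.
Qed.

(** The three equations are the instances [a_ik - a_jk = A_j a_ij] with [k = j - 1], where [A_j] is
    the value forced by the weights, [b_(j-1) - B_(j-1) = A_j b_j]. *)
Lemma is_2N_storage4 (M : explicit_rk R 4) :
  let a := rk_a M in let b := rk_b M in
  a 2%N 1%N != 0 -> a 3%N 2%N != 0 -> a 4%N 3%N != 0 ->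
  b 2%N != 0 -> b 3%N != 0 -> b 4%N != 0 ->
  a 3%N 1%N = a 2%N 1%N + (b 1%N - a 2%N 1%N) / b 2%N * a 3%N 2%N ->
  a 4%N 1%N = a 2%N 1%N + (b 1%N - a 2%N 1%N) / b 2%N * a 4%N 2%N ->
  a 4%N 2%N = a 3%N 2%N + (b 2%N - a 3%N 2%N) / b 3%N * a 4%N 3%N ->
  is_2N_storage M.
Proof.
move=> a b a21 a32 a43 b2 b3 b4 a31E a41E a42E; apply/is_2N_storageP.
exists (fun i => if (2 <= i <= 4)%N then (b i.-1 - a i i.-1) / b i else 0).
exists (fun i => if (i < 4)%N then a i.+1 i else b 4%N).
split=> [//|[|[|[|[|[|]]]]] // _|[|[|[|[|[|i]]]]] [|[|[|[|j]]]] // _ _ _|[|[|[|[|[|j]]]]] // _];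
  rewrite /storage_coef /index_iota unlock /= -/a -/b ?a41E ?a31E ?a42E; field;
  rewrite ?b2 ?b3 ?b4 //.
Qed.

Definition rk4 (a21 a31 a32 a41 a42 a43 : R) (b : nat -> R) : explicit_rk R 4.
Proof.
refine (@ExplicitRK R 4 (fun i j =>
  match i, j with
  | 2, 1 => a21 | 3, 1 => a31 | 3, 2 => a32
  | 4, 1 => a41 | 4, 2 => a42 | 4, 3 => a43 | _, _ => 0
  end) b _).
by do 5![case=> //]; do 4!case=> //.
Defined.

End FourStages.

Theorem mainTheorem7 (R : realType) (c b : nat -> R)
  (c1_0 : c 1%N = 0)
  (c2_neq0 : c 2%N != 0) (c3_neq0 : c 3%N != 0) (c4_neq0 : c 4%N != 0)
  (c2_neq_c3 : c 2%N != c 3%N) (c3_neq_c4 : c 3%N != c 4%N)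
  (b2_neq0 : b 2%N != 0) (b3_neq0 : b 3%N != 0) (b4_neq0 : b 4%N != 0)
  (den2_neq0 : b 1%N + b 2%N - c 2%N != 0)
  (den3_neq0 : b 1%N + b 2%N + b 3%N - c 3%N != 0) :
  ((exists M : explicit_rk R 4, third_order_2N_with c b M) <->
   [/\ b 1%N = 1 - b 2%N - b 3%N - b 4%N,
       b 3%N = (c 4%N / 2 - 1 / 3) / (c 3%N * (c 4%N - c 3%N))
               - c 2%N * (c 4%N - c 2%N) / (c 3%N * (c 4%N - c 3%N)) * b 2%N,
       b 4%N = (1 / 3 - c 3%N / 2) / (c 4%N * (c 4%N - c 3%N))
               + c 2%N * (c 3%N - c 2%N) / (c 4%N * (c 4%N - c 3%N)) * b 2%N &
       quadratic_lhs (c 2%N) (c 3%N) (c 4%N) (b 2%N * c 2%N) = 0])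
  /\
  (forall M : explicit_rk R 4, third_order_2N_with c b M ->
     (forall i j : nat, (2 <= j)%N -> (j < i)%N -> (i <= 4)%N ->
        rk_a M i j = b j / (\sum_(1 <= k < j.+1) b k - c j)
                     * (c i - c j - \sum_(j.+1 <= k < i) rk_a M i k))
     /\
     (forall i : nat, (2 <= i <= 4)%N ->
        rk_a M i 1%N = c i - \sum_(2 <= k < i) rk_a M i k)).
Proof.
have partial_sums : (\sum_(1 <= k < 3) b k = b 1%N + b 2%N) *
                    (\sum_(1 <= k < 4) b k = b 1%N + b 2%N + b 3%N).
  by split; rewrite /index_iota unlock /=; ring.
have a_formula (M : explicit_rk R 4) i j : third_order_2N_with c b M ->
    (2 <= j)%N -> (j < i)%N -> (i <= 4)%N ->
    rk_a M i j = b j / (\sum_(1 <= k < j.+1) b k - c j)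
                 * (c i - c j - \sum_(j.+1 <= k < i) rk_a M i k).
  move=> [eq_c eq_b stM _] le2j lt_ji le_i4.
  have sum_b : \sum_(1 <= k < j.+1) rk_b M k = \sum_(1 <= k < j.+1) b k.
    by apply: eq_big_nat => k kP; rewrite eq_b //; lia.
  rewrite storage_aE // ?sum_b ?eq_c ?eq_b //; try lia.
  (* Only two denominators occur, those assumed nonzero. *)
  have : (j == 2) || (j == 3) by lia.
  by case/orP=> /eqP ->; rewrite partial_sums.
split; last first.
  move=> M mM; split=> [i j|i iP]; first exact: a_formula.
  case: mM => eq_c _ _ _; rewrite -eq_c; last by lia.
  by rewrite (@rk_c_recr _ _ M i 1) ?big_nat1 ?addrK //; lia.
split=> [[M mM]|[b1E b3E b4E quad]].
  case: (mM) => eq_c eq_b _ /(third_order4 c1_0 eq_c eq_b)[e1 e2 e3 e4].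
  have [b1E b3E b4E] := (quadrature_weights _ _ _ _ _ c3_neq0 c4_neq0 c3_neq_c4).1 (And3 e1 e2 e3).
  split=> //.
  (* The quadratic is a multiple of the residual of the last order condition, which [e4] makes
     zero. *)
  rewrite (@quadratic_lhsE _ (b 1%N) _ (b 3%N) (b 4%N) _ _ _
            (rk_a M 3 2) (rk_a M 4 2) (rk_a M 4 3)) //.
  - by rewrite e4 subrr mulr0.
  - by rewrite (a_formula M) // partial_sums big_geq // subr0.
  - by rewrite (a_formula M) // partial_sums big_geq // subr0.
  - by rewrite (a_formula M) // partial_sums big_nat1.
have c32_neq0 : c 3%N - c 2%N != 0 by rewrite subr_eq0 eq_sym.
have c43_neq0 : c 4%N - c 3%N != 0 by rewrite subr_eq0 eq_sym.
(* The recursion dictates columns 2 and 3; column 1 is then chosen so that the row sums are the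
   [c_i]. *)
pose a32 := b 2%N / (b 1%N + b 2%N - c 2%N) * (c 3%N - c 2%N).
pose a43 := b 3%N / (b 1%N + b 2%N + b 3%N - c 3%N) * (c 4%N - c 3%N).
pose a42 := b 2%N / (b 1%N + b 2%N - c 2%N) * (c 4%N - c 2%N - a43).
pose M := rk4 (c 2%N) (c 3%N - a32) a32 (c 4%N - a42 - a43) a42 a43 b.
have eq_c (i : nat) : (1 <= i <= 4)%N -> rk_c M i = c i.
  case: i => [|[|[|[|[|i]]]]] // _; rewrite /rk_c /index_iota unlock /= ?c1_0 //; ring.
exists M; split=> //.
  (* The subdiagonal entries are nonzero because [c_2] is nonzero and consecutive nodes differ. *)
  by apply: is_2N_storage4; rewrite //= ?mulf_neq0 ?invr_neq0 //;
    rewrite /a42 /a32 /a43; field; rewrite ?b2_neq0 ?b3_neq0 ?den2_neq0 ?den3_neq0.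
apply/(third_order4 c1_0 eq_c (fun _ _ => erefl)).
have [e1 e2 e3] := (quadrature_weights _ _ _ _ _ c3_neq0 c4_neq0 c3_neq_c4).2 (And3 b1E b3E b4E).
(* All other factors in [quadratic_lhsE] are nonzero, so the residual vanishes. *)
split=> //=; apply/eqP; rewrite -subr_eq0.
move: quad; rewrite (quadratic_lhsE c3_neq0 c4_neq0 c3_neq_c4 b1E b3E b4E
  den2_neq0 den3_neq0 (erefl a32) (erefl a43) (erefl a42)) => /eqP.
rewrite !mulf_eq0 ?expf_eq0 /= (negbTE c3_neq0) (negbTE c4_neq0) (negbTE den2_neq0).
by rewrite (negbTE den3_neq0) (negbTE c43_neq0).
Qed.
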